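(* Let $T=(V,E)$ be a tree. Let $l$ be the total number of major stems of $T$ having at least one mid leg, let $v_1,\dots,v_l$ be these major stems, and let $m_i\ge 1$ be the number of mid legs attached to $v_i$, $1\le i\le l$. Then $$\beta(T^{3})\ \ge\ \beta(T)+\sum_{i=1}^{l} m_i-l .$$
   Context: All graphs are finite, simple, undirected and connected; $d_G$ denotes shortest-path distance. A set $S\subseteq V(G)$ is a resolving set of $G$ if for all distinct $u,v\in V(G)$ there is $s\in S$ with $d_G(s,u)\ne d_G(s,v)$; the metric dimension $\beta(G)$ is the minimum cardinality of a resolving set. For a tree $T$, $T^3$ is the graph on $V(T)$ in which distinct $u,v$ are adjacent iff $d_T(u,v)\le 3$. A branch of $T$ at a vertex $v$ is the subgraph induced by $v$ together with one component of $T\setminus\{v\}$. If $\deg(v)\ge 3$, a branch at $v$ that is a path is called a leg attached to $v$, and $v$ is called the stem of that leg; the length of a leg is its number of edges. A major stem is a stem having at least two legs. A mid leg is a leg of length exactly 2. *)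

(* Defs.v *)
From mathcomp Require Import all_boot.

Set Implicit Arguments.
Unset Strict Implicit.
Unset Printing Implicit Defensive.

(* A graph is given by its adjacency relation e on a finite type of vertices. *)

Section Metric.

Variables (T : finType) (e : rel T).

Definition walk_of_length (u v : T) (n : nat) : bool :=
  [exists p : n.-tuple T, path e u p && (last u p == v)].

(* Least length of a walk from u to v. Such a walk has length < #|T| whenever
   one exists, and [find] takes the junk value #|T| if there is none. *)
Definition dist (u v : T) : nat :=
  find (walk_of_length u v) (iota 0 #|T|).

Definition resolving (S : {set T}) : bool :=
  [forall u, forall v, (u != v) ==> [exists s in S, dist s u != dist s v]].

Definition metric_dim : nat :=
  #|[arg min_(S < [set: T] | resolving S) #|S|]|.

Definition graph_power (k : nat) : rel T :=
  [rel u v | (u != v) && (dist u v <= k)].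

End Metric.

Section Trees.

Variables (T : finType) (e : rel T).

Record is_tree : Prop := IsTree {
  tree_nonempty : 0 < #|T|;
  tree_sym : symmetric e;
  tree_irrefl : irreflexive e;
  tree_connected : forall u v : T, connect e u v;
  tree_acyclic : forall c : seq T, 2 < size c -> ~ ucycle e c }.

Definition degree (v : T) : nat := #|[set w | e v w]|.

Definition del_vertex (v : T) : rel T :=
  [rel x y | [&& x != v, y != v & e x y]].

(* Induced subgraphs, in particular branches, are represented by their vertex
   sets. *)
Definition branches (v : T) : {set {set T}} :=
  [set v |: [set y | connect (del_vertex v) x y] | x in [set~ v]].

Definition edges_in (B : {set T}) : {set {set T}} :=
  [set [set xy.1; xy.2] | xy in [set xy | [&& xy.1 \in B, xy.2 \in B &
                                             e xy.1 xy.2]]].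

(* B can be enumerated so that adjacent vertices are exactly the consecutive
   ones, i.e. the subgraph induced by B is a path. *)
Definition induces_path (B : {set T}) : bool :=
  [exists p : #|B|.-tuple T, perm_eq p (enum B) &&
    [forall i, forall j,
       e (tnth p i) (tnth p j) == ((i.+1 == j :> nat) || (j.+1 == i :> nat))]].

Definition legs (v : T) : {set {set T}} :=
  [set B in branches v | (3 <= degree v) && induces_path B].

Definition leg_length (B : {set T}) : nat := #|edges_in B|.

Definition major_stem (v : T) : bool := 2 <= #|legs v|.

Definition mid_legs (v : T) : {set {set T}} :=
  [set B in legs v | leg_length B == 2].

Definition mid_major_stems : {set T} :=
  [set v | major_stem v && (1 <= #|mid_legs v|)].

End Trees.

Lemma walk_of_lengthP (T : finType) (e : rel T) (u v : T) (n : nat) :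
  reflect (exists p, [/\ path e u p, last u p = v & size p = n])
          (walk_of_length e u v n).
Proof.
apply: (iffP existsP) => [[p /andP[pp /eqP lp]]|[p [pp lp /eqP sp]]].
  by exists p; rewrite size_tuple.
by exists (Tuple sp); rewrite /= pp lp eqxx.
Qed.

Lemma dist_walk (T : finType) (e : rel T) (u v : T) :
  connect e u v -> walk_of_length e u v (dist e u v).
Proof.
move=> /connectP[p pp ->]; case/shortenP: pp => q qp uq _.
have hq : size q < #|T| by apply: leq_trans (max_card (mem (u :: q)));
  rewrite (card_uniqP uq).
have h : has (walk_of_length e u (last u q)) (iota 0 #|T|).
  apply/hasP; exists (size q); first by rewrite mem_iota.
  by apply/walk_of_lengthP; exists q.
have := nth_find 0 h; rewrite nth_iota ?add0n //.
by have := h; rewrite has_find size_iota.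
Qed.

Lemma dist_le (T : finType) (e : rel T) (u : T) (p : seq T) :
  path e u p -> dist e u (last u p) <= size p.
Proof.
move=> pp; rewrite leqNgt; apply/negP => lt_p.
have ltT : size p < #|T|.
  by apply: leq_trans lt_p _; rewrite -[X in _ <= X](size_iota 0) find_size.
have := before_find 0 lt_p; rewrite nth_iota // add0n.
by case/walk_of_lengthP; exists p.
Qed.

Lemma dist_eq0 (T : finType) (e : rel T) (u v : T) :
  (dist e u v == 0) = (u == v).
Proof.
apply/eqP/eqP => [|<-]; last by have := @dist_le T e u [::] isT; case: dist.
rewrite /dist => d0; have T0 : 0 < #|T| by apply/card_gt0P; exists u.
have h : has (walk_of_length e u v) (iota 0 #|T|).
  by rewrite has_find size_iota d0.
have := nth_find 0 h; rewrite d0 nth_iota //.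
by case/walk_of_lengthP => -[|x p] [].
Qed.

Lemma resolving_setT (T : finType) (e : rel T) : resolving e [set: T].
Proof.
apply/forallP => u; apply/forallP => v; apply/implyP => uv.
apply/existsP; exists u; rewrite in_setT /=.
have /eqP -> : dist e u u == 0 by rewrite dist_eq0.
by rewrite eq_sym dist_eq0.
Qed.

Lemma metric_dimP (T : finType) (e : rel T) :
  (exists2 S, resolving e S & #|S| = metric_dim e) /\
  (forall S, resolving e S -> metric_dim e <= #|S|).
Proof.
rewrite /metric_dim; case: arg_minnP => [|S rS minS].
  exact: resolving_setT.
by split=> //; exists S.
Qed.

(* Hence the subtraction of #|mid_major_stems e| from this sum is exact. *)
Lemma mid_major_stems_le_sum (T : finType) (e : rel T) :
  #|mid_major_stems e| <= \sum_(v in mid_major_stems e) #|mid_legs e v|.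
Proof.
by rewrite -sum1_card; apply: leq_sum => v; rewrite inE => /andP[].
Qed.

(* Main.v *)
Require Import Defs.
From mathcomp Require Import all_boot zify.

(* Distances in T^3 are those of T divided by 3 and rounded up, so a set S
   resolving T^3 also resolves T; it is even redundant there. Let a, b be the
   vertices of a mid leg at v, with a adjacent to v and b the end. Over all the
   mid legs at v, at most one a and at most one b lie outside S, since in the
   cube two of the same kind are resolved only by themselves. So at each v all
   the ends b but one can be discarded from S, and the spared end can be
   chosen so that what remains still resolves T. This is checked on pairs of
   vertices with a common neighbour, which suffices in a tree. *)

Set Implicit Arguments.
Unset Strict Implicit.
Unset Printing Implicit Defensive.

(** * Distances in a connected graph and in its powers *)

Section ConnectedGraph.

Variables (T : finType) (e : rel T).
Hypothesis e_conn : forall u v : T, connect e u v.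

Local Notation d := (dist e).

Lemma dist_path (u v : T) :
  exists p, [/\ path e u p, last u p = v & size p = d u v].
Proof. exact/walk_of_lengthP/dist_walk. Qed.

Lemma distxx (u : T) : d u u = 0.
Proof. by apply/eqP; rewrite dist_eq0. Qed.

Lemma dist_triangle (w u v : T) : d u v <= d u w + d w v.
Proof.
have [p [pp lp <-]] := dist_path u w; have [q [qq lq <-]] := dist_path w v.
have -> : v = last u (p ++ q) by rewrite last_cat lp.
by rewrite -size_cat; apply: dist_le; rewrite cat_path pp lp qq.
Qed.

Lemma dist_sym (u v : T) : symmetric e -> d u v = d v u.
Proof.
move=> e_sym; suff le x y : d x y <= d y x by apply/eqP; rewrite eqn_leq !le.
have [p [pp lp <-]] := dist_path y x.
have rp : path e x (rev (belast y p)).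
  by rewrite -lp rev_path (eq_path (e' := e)).
have := dist_le rp; rewrite size_rev size_belast; congr (d _ _ <= _).
by case: p lp {pp rp} => [/= ->|z p] //=; rewrite rev_cons last_rcons.
Qed.

Lemma dist_edge (u v : T) : e u v -> d u v <= 1.
Proof. by move=> uv; have := @dist_le _ e u [:: v]; rewrite /= uv; apply. Qed.

Lemma dist_split (m n : nat) (u v : T) :
  d u v <= m + n -> exists z, d u z <= m /\ d z v <= n.
Proof.
have [p [pp lp <-]] := dist_path u v => sz.
move: pp lp; rewrite -(cat_take_drop m p) cat_path last_cat => /andP[p1 p2] lp.
exists (last u (take m p)); split.
  by apply: leq_trans (dist_le p1) _; rewrite size_take_min geq_minl.
by rewrite -lp; apply: leq_trans (dist_le p2) _; rewrite size_drop leq_subLR.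
Qed.

Lemma dist_step (u v : T) :
  u != v -> exists2 w, e u w & d u v = (d w v).+1.
Proof.
have [[|w p] [/= pp lp sp]] := dist_path u v; first by rewrite lp eqxx.
move=> _; case/andP: pp => uw pp; exists w => //.
have := dist_le pp; rewrite lp; have := dist_triangle w u v.
by have := dist_edge uw; lia.
Qed.

End ConnectedGraph.

(** Bounds for all [n] express division by [k] with rounding up. An edge of the power spans at most
    [k] steps; conversely a shortest path is cut into pieces of length at most [k]. *)
Lemma dist_power_le (T : finType) (e : rel T) (k n : nat) (u v : T) :
    (forall x y : T, connect e x y) -> 0 < k ->
  (dist (graph_power e k) u v <= n) = (dist e u v <= k * n).
Proof.
move=> e_conn k0; set g := graph_power e k.
have gconn x y : connect g x y.
  apply: (connect_sub _ (e_conn x y)) => a b ab.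
  have [->|ab'] := eqVneq a b; first exact: connect0.
  by apply: connect1; rewrite /g /graph_power /= ab' (leq_trans (dist_edge ab)).
apply/idP/idP.
  elim: n u => [|n IHn] u.
    by rewrite muln0 !leqn0 !dist_eq0.
  have [->|uv] := eqVneq u v; first by rewrite !distxx.
  have [w /andP[_ uw] ->] := dist_step gconn uv => /IHn wv.
  by apply: leq_trans (dist_triangle e_conn w _ _) _; rewrite mulnS leq_add.
elim: n u => [|n IHn] u.
  by rewrite muln0 !leqn0 !dist_eq0.
rewrite mulnS => /(dist_split e_conn)[z [uz /IHn zv]].
apply: leq_trans (dist_triangle gconn z _ _) _; rewrite -add1n leq_add //.
have [->|uz'] := eqVneq u z; first by rewrite !distxx.
by apply: dist_edge; rewrite /g /graph_power /= uz' uz.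
Qed.

Lemma dist_power_eq (T : finType) (e : rel T) (k : nat) (u v w : T) :
    (forall x y : T, connect e x y) -> 0 < k ->
  dist e u v = dist e u w ->
  dist (graph_power e k) u v = dist (graph_power e k) u w.
Proof.
move=> e_conn k0 duv; apply/eqP; rewrite eqn_leq !dist_power_le //.
by rewrite duv -dist_power_le // -duv -dist_power_le // !leqnn.
Qed.

Lemma resolvingP (T : finType) (e : rel T) (S : {set T}) :
  reflect (forall u v, u != v -> exists2 s, s \in S & dist e s u != dist e s v)
          (resolving e S).
Proof.
apply: (iffP forallP) => [H u v uv|H u].
  by have /forallP/(_ v)/implyP/(_ uv)/exists_inP := H u.
by apply/forallP => v; apply/implyP => uv; apply/exists_inP/H.
Qed.

(** * Distances in a tree and a local criterion for resolving sets *)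

Section TreeDistance.

Variables (T : finType) (e : rel T).
Hypothesis treeT : is_tree e.

Local Notation d := (dist e).

Let e_sym := tree_sym treeT.
Let e_conn := tree_connected treeT.
Let dC (u v : T) : d u v = d v u := dist_sym e_conn u v e_sym.

Lemma path_del_vertex (x c : T) (p : seq T) :
  path (del_vertex e x) c p -> x \notin p.
Proof.
elim: p c => //= z p IHp c /andP[/and3P[_ zx _] /IHp].
by rewrite inE negb_or eq_sym zx.
Qed.

(** A simple path from [c] to [c'] avoiding [x] would close up through [x] to a cycle. *)
Lemma nbrs_disconnected (x c c' : T) :
  e x c -> e x c' -> c != c' -> ~~ connect (del_vertex e x) c c'.
Proof.
move=> xc xc' cc'; apply/negP => /connectP[p pp lp]; move: xc' cc'.
rewrite {c'}lp; case/shortenP: pp => -[|y q] pq uq _; first by rewrite eqxx.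
move=> xl _; apply: (@tree_acyclic _ _ treeT (x :: c :: y :: q)) => //.
have sub : subrel (del_vertex e x) e by move=> a b /and3P[].
apply/andP; split.
  change (path e x (rcons (c :: y :: q) x)).
  rewrite rcons_path [last _ _]/= e_sym xl andbT /= xc.
  exact: (sub_path sub pq).
rewrite cons_uniq uq andbT inE negb_or; apply/andP; split.
  by case/andP: pq => /and3P[]; rewrite eq_sym.
exact: path_del_vertex pq.
Qed.

(** Beyond [c], a shortest path from [c] to [s] meets only vertices closer to [s] than [x] is, so it
    avoids [x]. *)
Lemma closer_connected (x c s : T) :
  c != x -> d c s <= d x s -> connect (del_vertex e x) c s.
Proof.
elim: {c}(d c s) {-2}c (erefl (d c s)) => [|n IHn] c dc cx le.
  by move/eqP: dc; rewrite dist_eq0 => /eqP ->; exact: connect0.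
have cs : c != s by rewrite -(dist_eq0 e) dc.
have [y cy dy] := dist_step e_conn cs.
have yx : y != x by apply: contraTneq le => <-; lia.
apply: (connect_trans (y := y)); first by apply: connect1; rewrite /del_vertex /= cx yx.
by apply: IHn => //; lia.
Qed.

(** Only one neighbour of [x] can lead toward [s]: two that are no farther from [s] than [x] would
    be joined through [s] without [x]. *)
Lemma dist_other_nbr (x c c' s : T) :
    e x c -> e x c' -> c != c' -> d c s <= d x s ->
  d c' s = (d x s).+1.
Proof.
move=> xc xc' cc' le; apply/eqP; rewrite eqn_leq; apply/andP; split.
  apply: leq_trans (dist_triangle e_conn x _ _) _.
  by rewrite -add1n leq_add2r dist_edge // e_sym.
rewrite ltnNge; apply: contra (nbrs_disconnected xc xc' cc') => le'.
have neq y : e x y -> y != x.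
  by apply: contraTneq => ->; rewrite (tree_irrefl treeT).
have del_sym : connect_sym (del_vertex e x).
  by apply: sym_connect_sym => a b; rewrite /del_vertex /= e_sym andbCA.
apply: (connect_trans (y := s)); first exact/closer_connected/le/neq.
by rewrite del_sym; exact/closer_connected/le'/neq.
Qed.

Lemma dist_adj (x c s : T) :
  e x c -> d c s = (d x s).+1 \/ d x s = (d c s).+1.
Proof.
move=> xc; have [le|lt] := leqP (d c s) (d x s); last first.
  left; have := dist_triangle e_conn x c s.
  by move: xc; rewrite e_sym => /dist_edge; lia.
right; have [xs|xs] := eqVneq x s.
  move: le; rewrite -xs distxx // leqn0 dist_eq0 => /eqP cx.
  by rewrite cx (tree_irrefl treeT) in xc.
have [y xy dy] := dist_step e_conn xs.
have [-> //|cy] := eqVneq c y.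
by have := dist_other_nbr xc xy cy le; lia.
Qed.

Lemma odd_dist (u w s : T) : odd (d u s) = odd (d u w) (+) odd (d w s).
Proof.
elim: {u}(d u w) {-2}u (erefl (d u w)) => [|n IHn] u du.
  by move/eqP: du; rewrite dist_eq0 => /eqP ->; rewrite distxx.
have uw : u != w by rewrite -(dist_eq0 e) du.
have [y uy dy] := dist_step e_conn uw.
rewrite dy /= addNb -(IHn y); last by lia.
by have [->|->] := dist_adj s uy; rewrite /= ?negbK.
Qed.

(** The edge from [x] to [c] points toward [w] and away from [s], so the path from [s] to [w] runs
    through it. The induction slides this edge toward [w]: as [x] is the neighbour of [c] leading to
    [s], the next vertex is again farther from [s]. *)
Lemma dist_away (x c s w : T) :
    e x c -> d c s = (d x s).+1 -> d x w = (d c w).+1 ->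
  d w s = d x s + d x w.
Proof.
elim: {c}(d c w) {-2}c (erefl (d c w)) x => [|n IHn] c dc x xc dcs dxw.
  by move/eqP: dc dxw; rewrite dist_eq0 => /eqP <-; rewrite distxx // dcs; lia.
have cw : c != w by rewrite -(dist_eq0 e) dc.
have [y cy dy] := dist_step e_conn cw.
have xy : x != y by apply: contra_eq_neq dxw => ->; lia.
have cx : e c x by rewrite e_sym.
have dys : d y s = (d c s).+1 by apply: (dist_other_nbr cx cy xy); lia.
by rewrite (IHn y _ c); lia.
Qed.

(* Two vertices at odd distance are resolved by parity; two vertices at even
   distance are resolved as soon as the two neighbours of their midpoint in
   their respective directions are. *)
Lemma tree_resolving (S : {set T}) :
    (forall u w : T, u != w -> S != set0) ->
    (forall x c c', e x c -> e x c' -> c != c' ->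
       exists2 s, s \in S & d s c != d s c') ->
  resolving e S.
Proof.
move=> S_neq0 S_res; apply/resolvingP => u w uw.
case odd_uw: (odd (d u w)).
  have [s sS] := set0Pn _ (S_neq0 u w uw); exists s => //.
  apply/eqP => /(congr1 odd); rewrite !(dC s) (odd_dist u w s) odd_uw.
  by case: (odd _).
have := odd_double_half (d u w); rewrite odd_uw add0n.
set k := (d u w)./2 => dk.
have k0 : k != 0 by apply: contraNneq uw => kz; rewrite -(dist_eq0 e) -dk kz.
have [|x [ux xw]] := dist_split e_conn (m := k) (n := k) (u := u) (v := w).
  by rewrite -dk; lia.
have tri := dist_triangle e_conn x u w.
have [dxu dxw] : d x u = k /\ d x w = k by rewrite dC; lia.
have [c xc dcu] : exists2 c, e x c & d x u = (d c u).+1.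
  by apply: dist_step => //; rewrite -(dist_eq0 e) dxu.
have [c' xc' dcw] : exists2 c, e x c & d x w = (d c w).+1.
  by apply: dist_step => //; rewrite -(dist_eq0 e) dxw.
have cc' : c != c'.
  apply/eqP => ccE; rewrite -ccE in dcw.
  by have := dist_triangle e_conn c u w; rewrite (dC u c); lia.
have [s sS] := S_res _ _ _ xc xc' cc'; rewrite !(dC s) => sres.
exists s => //; rewrite !(dC s).
(* Exactly one of [c], [c'] leads toward [s]. The vertex among [u], [w] on the other side is at
   distance [d x s + k] from [s], the one on the side of [s] is strictly closer. *)
have [dc|dc] := dist_adj s xc; have [dc'|dc'] := dist_adj s xc'.
- by rewrite dc dc' eqxx in sres.
- rewrite (dist_away xc dc dcu); have := dist_triangle e_conn c' w s.
  by rewrite (dC w c'); lia.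
- rewrite (dist_away xc' dc' dcw); have := dist_triangle e_conn c u s.
  by rewrite (dC u c); lia.
- by have := dist_other_nbr xc xc' cc' (s := s); lia.
Qed.

End TreeDistance.

(** * Mid legs described by neighbourhoods *)

Section MidLegs.

Variables (T : finType) (e : rel T).
Hypothesis treeT : is_tree e.

Local Notation d := (dist e).

Let e_sym := tree_sym treeT.
Let e_conn := tree_connected treeT.
Let e_irr := tree_irrefl treeT.

(** Here [v] is the stem, [a] the middle and [b] the end. Neighbourhoods replace branches and
    induced paths because the distance arguments only look at the first step out of [a] or [b]. *)
Definition mid_leg (v a b : T) : bool :=
  [&& 3 <= degree e v, v != b, [set z | e a z] == [set v; b]
    & [set z | e b z] == [set a]].

Lemma mid_leg_nbr (v a b z : T) :
  mid_leg v a b -> e a z = (z == v) || (z == b).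
Proof. by case/and4P => _ _ /eqP/setP/(_ z); rewrite !inE. Qed.

Lemma mid_leg_tip_nbr (v a b z : T) : mid_leg v a b -> e b z = (z == a).
Proof. by case/and4P => _ _ _ /eqP/setP/(_ z); rewrite !inE. Qed.

Lemma mid_leg_neq (v a b : T) : mid_leg v a b -> [/\ v != a, a != b & v != b].
Proof.
move=> L; split; last by case/and4P: L.
  by apply/eqP => va; have := e_irr a; rewrite (mid_leg_nbr _ L) va eqxx.
by apply/eqP => ab; have := e_irr b; rewrite (mid_leg_tip_nbr _ L) ab eqxx.
Qed.

Lemma mid_leg_degree (v a b : T) :
  mid_leg v a b -> [/\ 3 <= degree e v, degree e a = 2 & degree e b = 1].
Proof.
case/and4P => dv vb /eqP Na /eqP Nb; split=> //; rewrite /degree.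
  by rewrite Na cards2 vb.
by rewrite Nb cards1.
Qed.

Lemma mid_leg_tip_inj (v a b v' a' : T) :
  mid_leg v a b -> mid_leg v' a' b -> v' = v /\ a' = a.
Proof.
move=> L L'; have aE : a' = a.
  by apply/eqP; rewrite -(mid_leg_tip_nbr _ L) (mid_leg_tip_nbr _ L').
split=> //; rewrite aE in L'; have := mid_leg_nbr v' L.
rewrite (mid_leg_nbr _ L') eqxx /= => /esym/orP[/eqP //|/eqP vb].
by have [_ _] := mid_leg_neq L'; rewrite vb eqxx.
Qed.

Lemma mid_leg_mid_inj (v a b v' b' : T) :
  mid_leg v a b -> mid_leg v' a b' -> v' = v /\ b' = b.
Proof.
move=> L L'; have := mid_leg_nbr b' L.
rewrite (mid_leg_nbr _ L') eqxx orbT => /esym/orP[/eqP bv|/eqP bE].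
  (* An end has degree 1 and a stem at least 3, so [b'] is not [v]. *)
  have [d3 _ _] := mid_leg_degree L; have [_ _ d1] := mid_leg_degree L'.
  by rewrite bv in d1; rewrite d1 in d3.
rewrite bE in L'; by have [-> _] := mid_leg_tip_inj L L'.
Qed.

Lemma mid_leg_mid_not_tip (v a b v' a' : T) :
  mid_leg v a b -> ~~ mid_leg v' a' a.
Proof.
move=> L; apply/negP => L'; have [_ d2 _] := mid_leg_degree L.
by have [_ _] := mid_leg_degree L'; rewrite d2.
Qed.

Lemma mid_leg_dist_tip (v a b s : T) :
  mid_leg v a b -> s != b -> d b s = (d a s).+1.
Proof.
move=> L sb; rewrite eq_sym in sb.
have [y] := dist_step e_conn sb.
by rewrite (mid_leg_tip_nbr _ L) => /eqP ->.
Qed.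

Lemma mid_leg_dist_mid (v a b s : T) :
  mid_leg v a b -> s != a -> s != b -> d a s = (d v s).+1.
Proof.
move=> L sa sb; rewrite eq_sym in sa; have [y] := dist_step e_conn sa.
rewrite (mid_leg_nbr _ L) => /orP[] /eqP -> //.
by have := mid_leg_dist_tip L sb; lia.
Qed.

(** A neighbour of [a] or [b] other than [v] stays in their component of the tree without [v], which
    is just [a] and [b]. *)
Lemma branch_mid_leg (v a b x : T) :
    3 <= degree e v -> x != v ->
    v |: [set y | connect (del_vertex e v) x y] =i [:: v; a; b] ->
    uniq [:: v; a; b] -> e v a -> e a b -> ~~ e v b ->
  mid_leg v a b.
Proof.
move=> dv xv BE /and3P[]; rewrite !inE negb_or => /andP[va vb] ab _ eva eab evb.
have inC y : y != v ->
    connect (del_vertex e v) x y = (y == a) || (y == b).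
  by move=> yv; have := BE y; rewrite !inE (negPf yv).
have step y z : y != v -> z != v -> (y == a) || (y == b) -> e y z ->
    (z == a) || (z == b).
  move=> yv zv; rewrite -!inC // => xy yz; apply: connect_trans xy _.
  by apply: connect1; rewrite /del_vertex /= yv zv.
apply/and4P; split=> //; apply/eqP/setP => z; rewrite !inE.
  have [->|zv] /= := eqVneq z v; first by rewrite e_sym.
  have [->|zb] := eqVneq z b; first by [].
  apply/negP => az; have := step a z; rewrite eq_sym va eqxx (negPf zb) zv az.
  by move=> /(_ isT isT isT isT); rewrite orbF => /eqP zE; rewrite zE e_irr in az.
have [->|za] := eqVneq z a; first by rewrite e_sym.
apply/negP => bz; have [zE|zv] := eqVneq z v.
  by move: bz evb; rewrite zE e_sym => ->.
have := step b z; rewrite eq_sym vb eqxx orbT zv bz (negPf za).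
by move=> /(_ isT isT isT isT) /eqP zE; rewrite zE e_irr in bz.
Qed.

Lemma mem_mid_legs (v : T) (B : {set T}) :
    B \in mid_legs e v ->
  exists a b, mid_leg v a b /\ B = [set v; a; b].
Proof.
rewrite !inE => /andP[/and3P[/imsetP[x]]].
rewrite !inE => xv BE dv /existsP[p /andP[pB /forallP adjp] /eqP eB].
have pE : tval p =i B by move=> z; rewrite (perm_mem pB) mem_enum.
have up : uniq p by rewrite (perm_uniq pB) enum_uniq.
have adj i j : i < size p -> j < size p ->
    e (nth v p i) (nth v p j) = (i.+1 == j) || (j.+1 == i).
  rewrite size_tuple => iB jB; have /forallP/(_ (Ordinal jB))/eqP := adjp (Ordinal iB).
  by rewrite !(tnth_nth v).
have edge y z : y \in B -> z \in B -> e y z -> [set y; z] \in edges_in e B.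
  move=> yB zB yz; apply/imsetP; exists (y, z) => //=.
  by rewrite inE /= yB zB.
have vB : v \in B by rewrite BE !inE eqxx.
have xB : x \in B by rewrite BE !inE connect0 orbT.
move: eB; rewrite /leg_length; clear pB adjp.
case: (tval p) adj up pE => {p} [|p0 [|p1 [|p2 [|p3 p]]]] adj up pE.
- by move: vB; rewrite -pE.
- by move: vB xB xv; rewrite -!pE !inE => /eqP -> ->.
(* Two vertices span at most one edge. *)
- suff /subset_leq_card : edges_in e B \subset [set [set p0; p1]].
    by rewrite cards1 => le eB; rewrite eB in le.
  apply/subsetP => E /imsetP[[y z]]; rewrite !inE /= -!pE !inE => /and3P[].
  move=> /orP[]/eqP -> /orP[]/eqP -> //; rewrite ?e_irr // => _ -> //.
  by rewrite setUC.
- move=> _; have BE3 : B =i [:: p0; p1; p2] by move=> z; rewrite pE.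
  have [e01 e12 e02] : [/\ e p0 p1, e p1 p2 & ~~ e p0 p2].
    by have := (adj 0 1 isT isT, adj 1 2 isT isT, adj 0 2 isT isT);
       move=> [[/= -> ->] ->].
  move: (vB); rewrite BE3 !inE => /or3P[] /eqP vE; rewrite -{}vE in BE3 up e01 e12 e02.
  + exists p1, p2; split.
      by apply: (@branch_mid_leg v p1 p2 x) => // z; rewrite -BE -BE3.
    by apply/setP => z; rewrite BE3 !inE orbA.
  (* With [v] in the middle of the path, [p0] and [p2] would be two neighbours of [v] in one
     component of the tree without [v]. *)
  + have evp0 : e v p0 by rewrite e_sym.
    have p02 : p0 != p2.
      by move: up => /= /andP[]; rewrite !inE negb_or => /andP[].
    have inC z : e v z -> z \in B -> connect (del_vertex e v) x z.
      rewrite BE !inE => vz /orP[/eqP zv|//].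
      by rewrite zv e_irr in vz.
    have := nbrs_disconnected treeT evp0 e12 p02; case/negP.
    have del_sym : connect_sym (del_vertex e v).
      by apply: sym_connect_sym => a b; rewrite /del_vertex /= e_sym andbCA.
    apply: (connect_trans (y := x)); first by rewrite del_sym inC ?BE3 ?inE ?eqxx.
    by rewrite inC ?BE3 ?inE ?eqxx ?orbT.
  + have perm3 z : (z \in [:: v; p1; p0]) = (z \in [:: p0; p1; v]).
      by rewrite !inE orbC -orbA orbCA orbA orbC orbA orbC.
    exists p1, p0; split.
      apply: (@branch_mid_leg v p1 p0 x) => //.
      * by move=> z; rewrite -BE perm3 BE3.
      * by rewrite -(rev_uniq [:: p0; p1; v]) in up.
      * by rewrite e_sym.
      * by rewrite e_sym.
      * by rewrite e_sym.
    by apply/setP => z; rewrite BE3 -perm3 !inE orbA.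
(* Four or more vertices give three distinct edges along the path. *)
- move=> eB; have pB i : i < 4 -> nth v [:: p0, p1, p2, p3 & p] i \in B.
    by move=> i4; rewrite -pE mem_nth //; apply: leq_trans i4 _.
  have /and4P[] := up; rewrite !inE !negb_or.
  move=> /and4P[n01 n02 n03 _] /and3P[n12 n13 _] /andP[n23 _] _.
  have : uniq [:: [set p0; p1]; [set p1; p2]; [set p2; p3]].
    rewrite /= !inE negb_or !andbT -!andbA; apply/and3P; split.
    + apply/eqP => /setP/(_ p0).
      by rewrite !inE eqxx (negPf n01) (negPf n02).
    + apply/eqP => /setP/(_ p0).
      by rewrite !inE eqxx (negPf n02) (negPf n03).
    + apply/eqP => /setP/(_ p1).
      by rewrite !inE eqxx (negPf n12) (negPf n13).
  move/card_uniqP => /= c3; suff : 3 <= #|edges_in e B| by rewrite eB.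
  rewrite -c3; apply/subset_leq_card/subsetP => E; rewrite !inE.
  case/or3P => /eqP ->; apply: edge.
  + exact: (pB 0).
  + exact: (pB 1).
  + by rewrite (adj 0 1).
  + exact: (pB 1).
  + exact: (pB 2).
  + by rewrite (adj 1 2).
  + exact: (pB 2).
  + exact: (pB 3).
  + by rewrite (adj 2 3).
Qed.

Definition mid_leg_tips (v : T) : {set T} :=
  [set b | [exists a, mid_leg v a b]].

(** The ends map onto the legs: a leg at [v] is recovered from its end [b] as [v], [b] and the
    neighbours of [b]. *)
Lemma card_mid_legs (v : T) : #|mid_legs e v| <= #|mid_leg_tips v|.
Proof.
pose f b := [set v; b] :|: [set a | e b a].
apply: leq_trans (leq_imset_card f _); apply/subset_leq_card/subsetP => B.
case/mem_mid_legs => a [b [L ->]]; apply/imsetP; exists b.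
  by rewrite inE; apply/existsP; exists a.
apply/setP => z; rewrite !inE (mid_leg_tip_nbr _ L).
by rewrite -!orbA [(z == a) || _]orbC.
Qed.

Lemma disjoint_mid_leg_tips (v v' : T) :
  v != v' -> [disjoint mid_leg_tips v & mid_leg_tips v'].
Proof.
apply: contraNT => /pred0Pn[b] /=; rewrite !inE.
by case/andP => /existsP[a L] /existsP[a' L']; have [->] := mid_leg_tip_inj L L'.
Qed.

End MidLegs.

(** * Discarding ends of mid legs from a resolving set of the cube *)

Section Thinning.

Variables (T : finType) (e : rel T).
Hypothesis treeT : is_tree e.

Local Notation d := (dist e).
Local Notation d3 := (dist (graph_power e 3)).

Let e_sym := tree_sym treeT.
Let e_conn := tree_connected treeT.
Let dC (u v : T) : d u v = d v u := dist_sym e_conn u v e_sym.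

Lemma dist_cube_near (w u v : T) :
  u != v -> d w u + d w v <= 3 -> d3 u v = 1.
Proof.
move=> uv le; apply/eqP; rewrite eqn_leq dist_power_le //.
rewrite (leq_trans (dist_triangle e_conn w _ _)) 1?dC //.
by rewrite lt0n dist_eq0.
Qed.

Lemma mid_leg_edge (v a b : T) : mid_leg e v a b -> e v a.
Proof. by move=> L; rewrite e_sym (mid_leg_nbr _ L) eqxx. Qed.

Lemma mid_leg_dist_stem (v a b : T) :
  mid_leg e v a b -> d v a <= 1 /\ d v b <= 2.
Proof.
move=> L; have va := dist_edge (mid_leg_edge L).
have ab : e a b by rewrite (mid_leg_nbr _ L) eqxx orbT.
split=> //; apply: leq_trans (dist_triangle e_conn a _ _) _.
by rewrite -[2]addn1 leq_add // dist_edge.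
Qed.

Variable S : {set T}.
Hypothesis S_resolving : resolving (graph_power e 3) S.

(** Equal distances in the tree stay equal after rounding, so a vertex resolving a pair in the cube
    also resolves it in the tree. *)
Lemma resolving_cube (u v : T) :
  u != v -> exists s, [/\ s \in S, d3 s u != d3 s v & d s u != d s v].
Proof.
move/(resolvingP _ _ S_resolving) => [s sS sne]; exists s; split=> //.
by apply: contraNneq sne => /dist_power_eq ->.
Qed.

(** A vertex off both legs is equally far from [a] and [a']. The ends [b] and [b'] are within 3 of
    both, so at distance 1 from both in the cube. *)
Lemma mid_leg_mid_missing (v a b a' b' : T) :
    mid_leg e v a b -> mid_leg e v a' b' -> a \notin S -> a' \notin S ->
  a = a'.
Proof.
move=> L L' aS a'S; apply/eqP; apply: contraT => aa'.
have [s [sS s3 /eqP s1]] := resolving_cube aa'.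
have sa : s != a by apply: contraNneq aS => <-.
have sa' : s != a' by apply: contraNneq a'S => <-.
have [va vb] := mid_leg_dist_stem L; have [va' vb'] := mid_leg_dist_stem L'.
have [sb|sb] := eqVneq s b.
  by rewrite -sb in vb; move: s3; rewrite !(dist_cube_near (w := v)) //; lia.
have [sb'|sb'] := eqVneq s b'.
  by rewrite -sb' in vb'; move: s3; rewrite !(dist_cube_near (w := v)) //; lia.
case: s1; rewrite !(dC s) (mid_leg_dist_mid treeT L) //.
by rewrite (mid_leg_dist_mid treeT L').
Qed.

(** As for the middles, with roles exchanged: [a] and [a'] are within 3 of both ends, hence adjacent
    to them in the cube. *)
Lemma mid_leg_tip_missing (v a b a' b' : T) :
    mid_leg e v a b -> mid_leg e v a' b' -> b \notin S -> b' \notin S ->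
  b = b'.
Proof.
move=> L L' bS b'S; apply/eqP; apply: contraT => bb'.
have [s [sS s3 /eqP s1]] := resolving_cube bb'.
have sb : s != b by apply: contraNneq bS => <-.
have sb' : s != b' by apply: contraNneq b'S => <-.
have [va vb] := mid_leg_dist_stem L; have [va' vb'] := mid_leg_dist_stem L'.
have [sa|sa] := eqVneq s a.
  by rewrite -sa in va; move: s3; rewrite !(dist_cube_near (w := v)) //; lia.
have [sa'|sa'] := eqVneq s a'.
  by rewrite -sa' in va'; move: s3; rewrite !(dist_cube_near (w := v)) //; lia.
case: s1; rewrite !(dC s) (mid_leg_dist_tip treeT L) //.
rewrite (mid_leg_dist_mid treeT L) // (mid_leg_dist_tip treeT L') //.
by rewrite (mid_leg_dist_mid treeT L').
Qed.

(* [j] is the end of the mid leg at [v] that is spared: an end missing from [S]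
   if there is one, else the end of a leg whose other vertex is missing. *)
Definition thinning_choice (v j : T) : Prop :=
  forall a b, mid_leg e v a b -> b != j ->
    b \in S /\ (a \in S \/ exists2 a', mid_leg e v a' j & a' \in S).

Lemma thinning_choice_exists (v : T) : exists j, thinning_choice v j.
Proof.
case: (pickP [pred ab | mid_leg e v ab.1 ab.2 && (ab.2 \notin S)]).
  move=> [a j] /= /andP[L jS]; exists j => a' b' L' b'j; split.
    by apply: contraNT b'j => b'S; rewrite (mid_leg_tip_missing L' L).
  (* If [a'] is missing, the middle [a] of the spared leg is in [S]: two missing middles would
     coincide, and so would their legs. *)
  have [a'S|a'S] := boolP (a' \in S); [by left | right; exists a => //].
  apply: contraNT b'j => aS; have aE := mid_leg_mid_missing L' L a'S aS.
  by rewrite aE in L'; have [_ ->] := mid_leg_mid_inj treeT L L'.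
move=> tipS0; have {tipS0} tipS a b : mid_leg e v a b -> b \in S.
  by move=> L; have := tipS0 (a, b); rewrite /= L => /negbFE.
case: (pickP [pred ab | mid_leg e v ab.1 ab.2 && (ab.1 \notin S)]).
  move=> [a j] /= /andP[L aS]; exists j => a' b' L' b'j.
  split; [exact: tipS L' | left].
  apply: contraNT b'j => a'S; have aE := mid_leg_mid_missing L' L a'S aS.
  by rewrite aE in L'; have [_ ->] := mid_leg_mid_inj treeT L L'.
(* Nothing is missing, so no end has to be spared; [v] serves as a dummy, being no end of a mid leg
   at [v]. *)
move=> midS; exists v => a b L _; split; [exact: tipS L | left].
by have := midS (a, b); rewrite /= L => /negbFE.
Qed.

Variable j : T -> T.
Hypothesis j_choice : forall v, thinning_choice v (j v).

Definition surplus : {set T} := \bigcup_v (mid_leg_tips e v :\ j v).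

Local Notation S' := (S :\: surplus).

Lemma surplusP (b : T) :
  reflect (exists v a, mid_leg e v a b /\ b != j v) (b \in surplus).
Proof.
apply: (iffP bigcupP) => [[v _]|[v [a [L bj]]]].
  by rewrite !inE => /andP[bj /existsP[a L]]; exists v, a.
by exists v => //; rewrite !inE bj; apply/existsP; exists a.
Qed.

Lemma surplus_sub : surplus \subset S.
Proof.
by apply/subsetP => b /surplusP[v [a [L bj]]]; have [] := j_choice L bj.
Qed.

(** An end determines its stem, so the discarded sets at different stems are disjoint, and each
    omits at most the one end [j v]. Stems outside [A] only enlarge [surplus]. *)
Lemma card_surplus (A : {set T}) :
  \sum_(v in A) #|mid_legs e v| <= #|surplus| + #|A|.
Proof.
have -> : #|surplus| = \sum_v #|mid_leg_tips e v :\ j v|.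
  rewrite -sum1_card partition_disjoint_bigcup.
    by apply: eq_bigr => v _; rewrite sum1_card.
  move=> v v' /(disjoint_mid_leg_tips treeT).
  by apply: disjointW; apply: subsetDl.
apply: (@leq_trans (\sum_(v in A) (#|mid_leg_tips e v :\ j v| + 1))).
  apply: leq_sum => v _; apply: leq_trans (card_mid_legs treeT v) _.
  by rewrite (cardsD1 (j v)) addnC leq_add2l leq_b1.
rewrite big_split /= sum1_card leq_add2r [X in _ <= X](bigID (mem A)) /=.
exact: leq_addr.
Qed.

Lemma mid_leg_mid_kept (v a b : T) : mid_leg e v a b -> a \in S -> a \in S'.
Proof.
move=> L aS; rewrite inE aS andbT; apply/surplusP => -[v' [a' [L' _]]].
by have := mid_leg_mid_not_tip v' a' L; rewrite L'.
Qed.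

(** This supplies the substitute for a discarded end: the middle of its own leg, or else the middle
    of the spared leg. Middles are never discarded. *)
Lemma kept_or_replaced (s : T) :
    s \in S ->
  s \in S' \/ exists v a, mid_leg e v a s /\
    (a \in S' \/ a \notin S /\
                 exists a' b', [/\ mid_leg e v a' b', b' != s & a' \in S']).
Proof.
move=> sS; have [/surplusP[v [a [L sj]]]|sR] := boolP (s \in surplus); last first.
  by left; rewrite inE sR sS.
right; exists v, a; split=> //; have [aS|aS] := boolP (a \in S).
  by left; exact: mid_leg_mid_kept L aS.
right; split=> //; have [_ []] := j_choice L sj; first by rewrite (negPf aS).
move=> [a' L' a'S]; exists a', (j v); split; rewrite 1?eq_sym //.
exact: mid_leg_mid_kept L' a'S.
Qed.

(** Two distinct vertices must be given, since a one-vertex tree is resolved by the empty set. *)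
Lemma thinned_neq0 (u w : T) : u != w -> S' != set0.
Proof.
move=> /resolving_cube[s [sS _ _]]; apply/set0Pn.
case: (kept_or_replaced sS) => [?|[v [a [_ [?|[_ [a' [b' [_ _ ?]]]]]]]]].
- by exists s.
- by exists a.
- by exists a'.
Qed.

(* A discarded vertex is the end of a mid leg, and outside its leg it resolves
   the same pairs as the other vertex of the leg, or of any other mid leg at
   the same stem. The latter fails for two neighbours of the stem, but in the
   cube the discarded vertex does not resolve those. *)
Lemma thinned_resolving_nbrs (x c c' : T) :
    e x c -> e x c' -> c != c' ->
  (exists2 s, s \in S' & d s c != d s c') \/ (exists v b, mid_leg e v x b).
Proof.
move=> xc xc' cc'; have [s [sS s3 s1]] := resolving_cube cc'.
case: (kept_or_replaced sS) => [sS'|[v [a [L H]]]]; first by left; exists s.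
(* Here the pair consists of [v] and [s], and [a] is adjacent to both, so it cannot replace [s]. *)
have [xa|xa] := eqVneq x a; first by right; exists v, s; rewrite xa.
have not_tip v0 a0 b0 y : mid_leg e v0 a0 b0 -> x != a0 -> e x y -> y != b0.
  move=> L0 xa0; apply: contraTneq => ->.
  by rewrite e_sym (mid_leg_tip_nbr _ L0).
have not_mid v0 a0 b0 y : mid_leg e v0 a0 b0 -> x != v0 -> x != b0 -> e x y ->
    y != a0.
  move=> L0 xv0 xb0; apply: contraTneq => ->.
  by rewrite e_sym (mid_leg_nbr _ L0) negb_or xv0.
have only_nbr v0 a0 : mid_leg e v0 a0 x -> False.
  move=> L0; move: xc xc' cc'; rewrite !(mid_leg_tip_nbr _ L0).
  by move=> /eqP -> /eqP ->; rewrite eqxx.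
have res_tip v0 a0 b0 : mid_leg e v0 a0 b0 -> x != a0 ->
    (d b0 c != d b0 c') = (d a0 c != d a0 c').
  move=> L0 xa0; rewrite !(mid_leg_dist_tip treeT L0) ?eqSS //.
    exact: not_tip L0 _ xc'.
  exact: not_tip L0 _ xc.
have res_mid v0 a0 b0 : mid_leg e v0 a0 b0 -> x != a0 -> x != v0 ->
    (d a0 c != d a0 c') = (d v0 c != d v0 c').
  move=> L0 xa0 xv0; have xb0 : x != b0.
    by apply/eqP => xb0; rewrite -xb0 in L0; exact: only_nbr L0.
  rewrite !(mid_leg_dist_mid treeT L0) ?eqSS //.
  - exact: not_mid L0 _ _ xc'.
  - exact: not_tip L0 _ xc'.
  - exact: not_mid L0 _ _ xc.
  - exact: not_tip L0 _ xc.
case: H => [aS'|[_ [a' [b' [L' _ a'S']]]]].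
  by left; exists a => //; rewrite -(res_tip _ _ _ L).
(* The end [s] is within 2 of [v], hence within 3 of every neighbour of [v]: in the cube it sees
   them all at distance 1, against the choice of [s]. *)
have [xv|xv] := eqVneq x v.
  have [_ sx] := mid_leg_dist_stem L; rewrite -xv in sx.
  have near y : e x y -> d3 s y = 1.
    move=> xy; apply: (dist_cube_near (w := x)).
      by rewrite eq_sym; exact: not_tip L _ xy.
    by have := dist_edge xy; lia.
  by rewrite !near ?eqxx in s3.
have [xa'|xa'] := eqVneq x a'; first by right; exists v, b'; rewrite xa'.
(* Resolution passes from [a'] to [v], then to [a], then to [s]. *)
left; exists a' => //; rewrite (res_mid _ _ _ L') // -(res_mid _ _ _ L) //.
by rewrite -(res_tip _ _ _ L).
Qed.

(** The stem has two neighbours besides [a], and its degree rules out being a middle, so some kept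
    vertex resolves them. It is neither [a] nor [b], which see both at distance 2 and 3
    respectively. *)
Lemma thinned_off_leg (v a b : T) :
  mid_leg e v a b -> exists s, [/\ s \in S', s != a & s != b].
Proof.
move=> L; have [dv da db] := mid_leg_degree L.
have [c [c' [Nc Nc' cc']]] : exists c c',
    [/\ c \in [set w | e v w] :\ a, c' \in [set w | e v w] :\ a & c != c'].
  have : 1 < #|[set w | e v w] :\ a|.
    by rewrite -ltnS (leq_trans dv) // /degree (cardsD1 a); case: (_ \in _).
  by case/card_gt1P => c [c' [? ? ?]]; exists c, c'.
move: Nc Nc'; rewrite !inE => /andP[ca vc] /andP[c'a vc'].
have cb y : e v y -> y != b.
  apply: contraTneq => ->; rewrite e_sym (mid_leg_tip_nbr _ L).
  by have [] := mid_leg_neq treeT L.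
case: (thinned_resolving_nbrs vc vc' cc') => [[s sS' ne]|[v' [b' L']]]; last first.
  by have [_ d2 _] := mid_leg_degree L'; rewrite d2 in dv.
have a1 y : e v y -> y != a -> d a y = 2.
  move=> vy ya; rewrite (mid_leg_dist_mid treeT L) ?cb //; congr _.+1.
  by have [|] := dist_adj treeT v vy; rewrite distxx dC.
exists s; split=> //; apply: contraNneq ne => ->.
  by rewrite !a1.
by rewrite !(mid_leg_dist_tip treeT L) ?cb // !a1.
Qed.

Lemma thinned_resolving : resolving e S'.
Proof.
apply: (tree_resolving treeT) => [u w|x c c' xc xc' cc'].
  exact: thinned_neq0.
case: (thinned_resolving_nbrs xc xc' cc') => // -[v [b L]].
have [s [sS' sa sb]] := thinned_off_leg L.
(* The remaining pair is [v], [b] around a middle [x]; any vertex off the leg is closer to [v]. *)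
have dsb : d s b = (d s v).+2.
  by rewrite !(dC s) (mid_leg_dist_tip treeT L) // (mid_leg_dist_mid treeT L).
exists s => //; move: xc xc' cc'; rewrite !(mid_leg_nbr _ L).
by case/orP => /eqP -> /orP[] /eqP ->; rewrite ?eqxx // dsb; lia.
Qed.

End Thinning.

Theorem theorem5p2 (T : finType) (e : rel T) (treeT : is_tree e) :
  metric_dim e + \sum_(v in mid_major_stems e) #|mid_legs e v|
    - #|mid_major_stems e|
  <= metric_dim (graph_power e 3).
Proof.
have [[S S_res <-] _] := metric_dimP (graph_power e 3).
have [j j_choice] := fin_all_exists (thinning_choice_exists treeT S_res).
have [_ /(_ _ (thinned_resolving treeT S_res j_choice))] := metric_dimP e.
have := card_surplus treeT j (mid_major_stems e).
rewrite cardsD (setIidPr (surplus_sub j_choice)).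
(* Since [surplus] lies in [S], the truncated subtraction in the size of the thinned set is
   exact. *)
by have := subset_leq_card (surplus_sub j_choice); lia.
Qed.
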